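(* The set of functors $\mathscr F^+=\{\mathbb O,\mathbb E,\mathbb G,\mathbb G_L,\mathbb G_R,\mathbb G_{LR},\mathbb F,\mathbb F_L,\mathbb F_R,\mathbb F_{LR},\mathbb Q,\mathbb P,\mathbb P_L,\mathbb P_R,\mathbb I\}$ is closed under composition, and hence is a monoid with identity $\mathbb I$. Its composition is given by the following rules (together with $\mathbb I\circ\mathbb Y=\mathbb Y$ for all $\mathbb Y$): - $\mathbb O\circ\mathbb Y=\mathbb O$ for all $\mathbb Y\in\mathscr F^+$. - $\mathbb E\circ\mathbb Y=\mathbb O$ for $\mathbb Y\in\{\mathbb O,\mathbb G,\mathbb G_L,\mathbb G_R\}$; $\mathbb E\circ\mathbb Y=\mathbb E$ for $\mathbb Y\in\{\mathbb E,\mathbb F,\mathbb F_L,\mathbb F_R,\mathbb F_{LR},\mathbb I\}$; $\mathbb E\circ\mathbb Y=\mathbb Q$ for $\mathbb Y\in\{\mathbb G_{LR},\mathbb Q,\mathbb P,\mathbb P_L,\mathbb P_R\}$. - For $\mathbb X\in\{\mathbb G,\mathbb G_L,\mathbb G_R,\mathbb G_{LR},\mathbb P,\mathbb P_L,\mathbb P_R\}$: $\mathbb X\circ\mathbb Y=\mathbb O$ for $\mathbb Y\in\{\mathbb O,\mathbb E,\mathbb Q\}$; $\mathbb X\circ\mathbb Y=\mathbb X$ for $\mathbb Y\in\{\mathbb G_{LR},\mathbb F_{LR},\mathbb I\}$; $\mathbb X\circ\mathbb Y=\mathbb G$ for $\mathbb Y\in\{\mathbb G,\mathbb G_L,\mathbb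 G_R,\mathbb F,\mathbb F_L,\mathbb F_R,\mathbb P,\mathbb P_L,\mathbb P_R\}$. - For $\mathbb X\in\{\mathbb F,\mathbb F_L,\mathbb F_R,\mathbb F_{LR}\}$: $\mathbb X\circ\mathbb O=\mathbb O$; $\mathbb X\circ\mathbb E=\mathbb E$; $\mathbb X\circ\mathbb Q=\mathbb Q$; $\mathbb X\circ\mathbb Y=\mathbb G$ for $\mathbb Y\in\{\mathbb G,\mathbb G_L,\mathbb G_R\}$; $\mathbb X\circ\mathbb Y=\mathbb F$ for $\mathbb Y\in\{\mathbb F,\mathbb F_L,\mathbb F_R\}$; $\mathbb X\circ\mathbb Y=\mathbb P$ for $\mathbb Y\in\{\mathbb P,\mathbb P_L,\mathbb P_R\}$; $\mathbb X\circ\mathbb Y=\mathbb X$ for $\mathbb Y\in\{\mathbb F_{LR},\mathbb I\}$; and $\mathbb F\circ\mathbb G_{LR}=\mathbb P$, $\mathbb F_L\circ\mathbb G_{LR}=\mathbb P_L$, $\mathbb F_R\circ\mathbb G_{LR}=\mathbb P_R$, $\mathbb F_{LR}\circ\mathbb G_{LR}=\mathbb G_{LR}$. - $\mathbb Q\circ\mathbb Y=\mathbb Q$ for $\mathbb Y\in\{\mathbb G_{LR},\mathbb F_{LR},\mathbb I\}$, and $\mathbb Q\circ\mathbb Y=\mathbb O$ for all other $\mathbb Y\in\mathscr F^+$. Moreover, the monoid $\mathscr F^+$ is $\mathscr J$-trivial (its $\mathscr J$-classes are singletons); its idempotents are exactly $\mathbb O,\mathbb E,\mathbb G,\mathbb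 G_{LR},\mathbb F,\mathbb F_{LR},\mathbb I$; its idempotent-generated submonoid is $\{\mathbb O,\mathbb E,\mathbb G,\mathbb G_{LR},\mathbb F,\mathbb F_{LR},\mathbb Q,\mathbb P,\mathbb I\}$; and the partial order $\leq_{\mathscr J}$ on $\mathscr F^+$ has precisely the following covering relations (smaller element first): $\mathbb O<\mathbb G$, $\mathbb O<\mathbb Q$, $\mathbb Q<\mathbb E$, $\mathbb Q<\mathbb P$, $\mathbb E<\mathbb F$, $\mathbb G<\mathbb G_L$, $\mathbb G<\mathbb G_R$, $\mathbb G<\mathbb P$, $\mathbb P<\mathbb P_L$, $\mathbb P<\mathbb P_R$, $\mathbb P<\mathbb F$, $\mathbb G_L<\mathbb G_{LR}$, $\mathbb G_R<\mathbb G_{LR}$, $\mathbb P_L<\mathbb G_{LR}$, $\mathbb P_R<\mathbb G_{LR}$, $\mathbb P_L<\mathbb F_L$, $\mathbb P_R<\mathbb F_R$, $\mathbb F<\mathbb F_L$, $\mathbb F<\mathbb F_R$, $\mathbb F_L<\mathbb F_{LR}$, $\mathbb F_R<\mathbb F_{LR}$, $\mathbb G_{LR}<\mathbb F_{LR}$, $\mathbb F_{LR}<\mathbb I$.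
   Context: $\mathcal M$ is the category of all monoids, with homomorphisms preserving identities; submonoids contain the identity. An element $x$ of a monoid $M$ is a left unit if $ax=1$ for some $a\in M$, a right unit if $xa=1$ for some $a\in M$. $\langle A\rangle$ denotes the submonoid generated by $A$. For a monoid $M$ define submonoids: $\mathbb O(M)=\{1\}$; $\mathbb I(M)=M$; $\mathbb E(M)$ is generated by all idempotents of $M$; $\mathbb G_L(M)$ is the set of left units; $\mathbb G_R(M)$ the set of right units; $\mathbb G(M)=\mathbb G_L(M)\cap\mathbb G_R(M)$; $\mathbb G_{LR}(M)=\langle\mathbb G_L(M)\cup\mathbb G_R(M)\rangle$; $\mathbb F(M)=\langle\mathbb E(M)\cup\mathbb G(M)\rangle$; $\mathbb F_L(M)=\langle\mathbb E(M)\cup\mathbb G_L(M)\rangle$; $\mathbb F_R(M)=\langle\mathbb E(M)\cup\mathbb G_R(M)\rangle$; $\mathbb F_{LR}(M)=\langle\mathbb E(M)\cup\mathbb G_L(M)\cup\mathbb G_R(M)\rangle$. Each such $\mathbb X$ is a functor $\mathcal M\to\mathcal M$: for a homomorphism $f:M\to N$, $\mathbb X(f)$ is the restriction of $f$ to a map $\mathbb X(M)\to\mathbb X(N)$. Composition is $(\mathbb X\circ\mathbb Y)(M)=\mathbb X(\mathbb Y(M))$, regarded as a submonoid of $M$; two functors of this kind are equal iff they give the same submonoid of $M$ for every monoid $M$. Define further $\mathbb Q=\mathbb E\circ\mathbb G_{LR}$, $\mathbb P=\mathbb F\circ\mathbb G_{LR}$, $\mathbb P_L=\mathbb F_L\circ\mathbb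 G_{LR}$, $\mathbb P_R=\mathbb F_R\circ\mathbb G_{LR}$. In a monoid $S$, $x\leq_{\mathscr J}y$ means $x=ayb$ for some $a,b\in S$, and $x\mathrel{\mathscr J}y$ means $x\leq_{\mathscr J}y$ and $y\leq_{\mathscr J}x$. *)

(* Defs.v *)
From Stdlib Require List.
From HB Require Import structures.
From mathcomp Require Import all_boot.
From mathcomp Require Import boolp classical_sets.

Set Implicit Arguments.
Unset Strict Implicit.
Unset Printing Implicit Defensive.

Local Open Scope classical_set_scope.

(* The notions below take a raw operation and raw predicates, rather than a
   monoidType and [set], so that they also apply to functors under composition:
   functors quantify over all of monoidType, hence live in a universe too large
   to be the carrier of a monoidType or the argument of [set]. *)

Definition submonoid_closed (T : Type) (op : T -> T -> T) (e : T)
    (A : T -> Prop) :=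
  A e /\ forall x y, A x -> A y -> A (op x y).

Definition generated (T : Type) (op : T -> T -> T) (e : T) (A : T -> Prop)
    (x : T) : Prop :=
  forall B : T -> Prop, submonoid_closed op e B -> (forall y, A y -> B y) -> B x.

Definition idempotent_elt (T : Type) (op : T -> T -> T) (x : T) : Prop :=
  op x x = x.

(* Green's J-preorder and J-relation of the monoid S under op; the multipliers
   range over S only. *)
Definition leJ (T : Type) (op : T -> T -> T) (S : T -> Prop) (x y : T) :=
  exists a b, [/\ S a, S b & x = op (op a y) b].

Definition eqJ (T : Type) (op : T -> T -> T) (S : T -> Prop) (x y : T) :=
  leJ op S x y /\ leJ op S y x.

Definition ltJ (T : Type) (op : T -> T -> T) (S : T -> Prop) (x y : T) :=
  leJ op S x y /\ x <> y.

(* y covers x *)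
Definition coversJ (T : Type) (op : T -> T -> T) (S : T -> Prop) (x y : T) :=
  [/\ S x, S y, ltJ op S x y &
      ~ exists z, [/\ S z, ltJ op S x z & ltJ op S z y]].

(* A monoidType carries a choice structure; by [boolp.gen_choiceMixin] every
   type has one, so quantifying over monoidType is quantifying over all
   monoids. *)
Record submonoid (M : monoidType) := Submonoid {
  carrier :> set M;
  carrierP : submonoid_closed (@mul M) 1%g carrier
}.

Lemma submonoid_eq (M : monoidType) (A B : submonoid M) :
  carrier A = carrier B -> A = B.
Proof.
case: A B => [A hA] [B hB] /= eAB; rewrite {}eAB in hA *.
by rewrite (Prop_irrelevance hA hB).
Qed.

Definition monoid_of (M : monoidType) (A : submonoid M) : Type :=
  set_type (carrier A).

Section MonoidOf.
Context (M : monoidType) (A : submonoid M).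

Lemma mem_closed : monoid_closed (fun x : M => x \in carrier A).
Proof.
have [A1 AM] := carrierP A; split; first exact: mem_set.
by move=> x y /set_mem Ax /set_mem Ay; apply/mem_set/AM.
Qed.

HB.instance Definition _ := SubChoice.on (monoid_of A).
HB.instance Definition _ :=
  SubChoice_isSubMonoid.Build M (fun x : M => x \in carrier A) (monoid_of A)
    mem_closed.

Definition emb (x : monoid_of A) : M := val x.

Lemma embP (x : monoid_of A) : carrier A (emb x).
Proof. exact/set_mem/(valP x). Qed.

Definition to_sub (x : M) (Ax : carrier A x) : monoid_of A :=
  exist _ x (mem_set Ax).

Lemma emb_to_sub x (Ax : carrier A x) : emb (to_sub Ax) = x.
Proof. by []. Qed.

Lemma emb_inj : injective emb.
Proof. exact: val_inj. Qed.

Lemma emb1 : emb 1%g = 1%g.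
Proof. exact: val1. Qed.

Lemma embM x y : emb (x * y)%g = (emb x * emb y)%g.
Proof. exact: valM. Qed.

End MonoidOf.

(* A functor assigning to each monoid M a submonoid X(M) and to each
   homomorphism M -> N its restriction X(M) -> X(N); the morphism part is
   determined by the object part, and functor_sub says that it is
   well-defined. *)
Record subfunctor := Subfunctor {
  obj :> forall M : monoidType, submonoid M;
  functor_sub : forall (M N : monoidType) (f : M -> N), monoid_morphism f ->
    forall x, carrier (obj M) x -> carrier (obj N) (f x)
}.

(* Leibniz equality of functors is agreement on all monoids. *)
Lemma subfunctorP (X Y : subfunctor) :
  X = Y <->
  forall (M : monoidType) (x : M), carrier (X M) x <-> carrier (Y M) x.
Proof.
split=> [-> //|eXY].
have {eXY} : obj X = obj Y.
  apply: functional_extensionality_dep => M; apply: submonoid_eq.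
  by apply/seteqP; split=> x /eXY.
case: X Y => [X hX] [Y hY] /= eXY; rewrite {}eXY in hX *.
by rewrite (Prop_irrelevance hX hY).
Qed.

(* X(f), the restriction of f *)
Definition restr (X : subfunctor) (M N : monoidType) (f : M -> N)
    (hf : monoid_morphism f) (x : monoid_of (X M)) : monoid_of (X N) :=
  to_sub (functor_sub hf (embP x)).

Lemma restr_morphism (X : subfunctor) (M N : monoidType) (f : M -> N)
  (hf : monoid_morphism f) : monoid_morphism (restr (X := X) hf).
Proof.
split.
  by apply: emb_inj; rewrite emb_to_sub !emb1 hf.1.
by move=> x y; apply: emb_inj; rewrite embM !emb_to_sub embM hf.2.
Qed.

Section Composition.
Context (X Y : subfunctor).

Definition comp_set (M : monoidType) : set M :=
  @emb M (Y M) @` X (monoid_of (Y M)).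

Lemma comp_closed (M : monoidType) : submonoid_closed (@mul M) 1%g (@comp_set M).
Proof.
have [X1 XM] := carrierP (X (monoid_of (Y M))); split.
  by exists 1%g => //; apply: emb1.
move=> _ _ [x Xx <-] [y Xy <-]; exists (x * y)%g; first exact: XM.
exact: embM.
Qed.

Definition comp_obj (M : monoidType) := Submonoid (comp_closed M).

Lemma comp_functor (M N : monoidType) (f : M -> N) : monoid_morphism f ->
  forall x, carrier (comp_obj M) x -> carrier (comp_obj N) (f x).
Proof.
move=> hf _ [x Xx <-]; exists (@restr Y _ _ _ hf x) => //.
exact: (functor_sub (restr_morphism Y hf) Xx).
Qed.

(* (X o Y)(M) = X(Y(M)), regarded as a submonoid of M *)
Definition compF : subfunctor := Subfunctor comp_functor.

End Composition.

Notation "X \oF Y" := (compF X Y) (at level 50, left associativity).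

Lemma generated_closed (T : Type) (op : T -> T -> T) (e : T) (A : T -> Prop) :
  submonoid_closed op e (generated op e A).
Proof.
split; first by move=> B [B1 _] _.
move=> x y hx hy B hB AB; have [_ BM] := hB.
by apply: BM; [apply: hx|apply: hy].
Qed.

Lemma generated_sub (T : Type) (op : T -> T -> T) (e : T) (A : T -> Prop) x :
  A x -> generated op e A x.
Proof. by move=> Ax B _; apply. Qed.

(* M |-> <A(M)> for a family A of subsets preserved by homomorphisms *)
Section Generated.
Context (A : forall M : monoidType, set M)
  (hA : forall (M N : monoidType) (f : M -> N), monoid_morphism f ->
     forall x, A M x -> A N (f x)).

Definition gen_obj (M : monoidType) : submonoid M :=
  Submonoid (generated_closed (@mul M) 1%g (@A M)).

Lemma gen_functor (M N : monoidType) (f : M -> N) : monoid_morphism f ->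
  forall x, carrier (gen_obj M) x -> carrier (gen_obj N) (f x).
Proof.
move=> [f1 fM] x hx; apply: (hx (fun y => carrier (gen_obj N) (f y))).
  have [G1 GM] := generated_closed (@mul N) 1%g (@A N).
  by split=> [|y z hy hz] /=; rewrite ?f1 ?fM //; apply: GM.
move=> y Ay; apply: generated_sub.
by apply: (hA (f := f)) => //; split.
Qed.

Definition genF : subfunctor := Subfunctor gen_functor.

End Generated.

Definition left_units (M : monoidType) : set M :=
  [set x | exists a : M, (a * x = 1)%g].

Definition right_units (M : monoidType) : set M :=
  [set x | exists a : M, (x * a = 1)%g].

Definition idems (M : monoidType) : set M := idempotent_elt (@mul M).

Section Preservation.
Context (M N : monoidType) (f : M -> N) (hf : monoid_morphism f).

Lemma idems_morph x : idems x -> idems (f x).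
Proof. by rewrite /idems /idempotent_elt -hf.2 => ->. Qed.

Lemma left_units_morph x : left_units x -> left_units (f x).
Proof. by case=> a ax1; exists (f a); rewrite -hf.2 ax1 hf.1. Qed.

Lemma right_units_morph x : right_units x -> right_units (f x).
Proof. by case=> a xa1; exists (f a); rewrite -hf.2 xa1 hf.1. Qed.

End Preservation.

Lemma left_units_closed (M : monoidType) : submonoid_closed (@mul M) 1%g (@left_units M).
Proof.
split; first by exists 1%g; rewrite mulg1.
move=> x y [a ax1] [b by1]; exists (b * a)%g.
by rewrite -mulgA (mulgA a) ax1 mul1g.
Qed.

Lemma right_units_closed (M : monoidType) : submonoid_closed (@mul M) 1%g (@right_units M).
Proof.
split; first by exists 1%g; rewrite mulg1.
move=> x y [a xa1] [b yb1]; exists (b * a)%g.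
by rewrite -mulgA (mulgA y) yb1 mul1g.
Qed.

Lemma units_closed (M : monoidType) :
  submonoid_closed (@mul M) 1%g (@left_units M `&` @right_units M).
Proof.
have [L1 LM] := left_units_closed M; have [R1 RM] := right_units_closed M.
by split=> // x y [Lx Rx] [Ly Ry]; split; [apply: LM|apply: RM].
Qed.

Lemma one_closed (M : monoidType) :
  submonoid_closed (@mul M) 1%g [set 1%g : M].
Proof. by split=> // x y -> ->; rewrite mulg1. Qed.

Lemma full_closed (M : monoidType) :
  submonoid_closed (@mul M) 1%g [set: M].
Proof. by []. Qed.

Definition fO : subfunctor.
Proof.
refine (@Subfunctor (fun M => Submonoid (one_closed M)) _).
by move=> M N f hf x /= ->; exact: hf.1.
Defined.

Definition fI : subfunctor.
Proof. by refine (@Subfunctor (fun M => Submonoid (full_closed M)) _). Defined.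

Definition fGL : subfunctor :=
  @Subfunctor (fun M => Submonoid (left_units_closed M)) left_units_morph.

Definition fGR : subfunctor :=
  @Subfunctor (fun M => Submonoid (right_units_closed M)) right_units_morph.

Definition fG : subfunctor.
Proof.
refine (@Subfunctor (fun M => Submonoid (units_closed M)) _).
move=> M N f hf x [Lx Rx].
by split; [apply: left_units_morph|apply: right_units_morph].
Defined.

Definition fE : subfunctor := genF idems_morph.

Definition fGLR : subfunctor.
Proof.
refine (@genF (fun M => fGL M `|` fGR M) _).
by move=> M N f hf x [hx|hx]; [left|right]; apply: (functor_sub hf).
Defined.

Definition fF : subfunctor.
Proof.
refine (@genF (fun M => fE M `|` fG M) _).
by move=> M N f hf x [hx|hx]; [left|right]; apply: (functor_sub hf).
Defined.

Definition fFL : subfunctor.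
Proof.
refine (@genF (fun M => fE M `|` fGL M) _).
by move=> M N f hf x [hx|hx]; [left|right]; apply: (functor_sub hf).
Defined.

Definition fFR : subfunctor.
Proof.
refine (@genF (fun M => fE M `|` fGR M) _).
by move=> M N f hf x [hx|hx]; [left|right]; apply: (functor_sub hf).
Defined.

Definition fFLR : subfunctor.
Proof.
refine (@genF (fun M => fE M `|` fGL M `|` fGR M) _).
by move=> M N f hf x [[hx|hx]|hx];
  [left; left|left; right|right]; apply: (functor_sub hf).
Defined.

Definition fQ : subfunctor := fE \oF fGLR.
Definition fP : subfunctor := fF \oF fGLR.
Definition fPL : subfunctor := fFL \oF fGLR.
Definition fPR : subfunctor := fFR \oF fGLR.

Definition Fplus_seq : seq subfunctor :=
  [:: fO; fE; fG; fGL; fGR; fGLR; fF; fFL; fFR; fFLR; fQ; fP; fPL; fPR; fI].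

Definition Fplus (X : subfunctor) : Prop := List.In X Fplus_seq.

(* Main.v *)
Require Import Defs.
From Stdlib Require List.
From HB Require Import structures.
From mathcomp Require Import all_boot.
From mathcomp Require Import boolp classical_sets.

Set Implicit Arguments.
Unset Strict Implicit.
Unset Printing Implicit Defensive.

Local Open Scope classical_set_scope.
Local Open Scope group_scope.

(** Call a functor Y bounded by Z when Y(M) is contained in Z(M) for every M
([subF]).  Every listed functor other than [fI] is a join: the submonoid
generated by an idempotent part, one of [fO], [fQ], [fE], and a unit part, one
of [fO], [fG], [fGL], [fGR], [fGLR].  As a join is defined by generators,
composing on the right distributes over it ([comp_join]), so the whole table
follows from what the idempotents and the one-sided units of Y(M) are, for each
listed Y.

For idempotents: if Y(M) has all idempotents of M, it generates E(M)
([E_comp_full]); if all its elements are left units, or all are right units,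
its only idempotent is 1 ([E_comp_units]); if it lies between Q(M) and GLR(M),
its idempotents generate Q(M) ([E_comp_between]).

For units: if Y(M) contains all one-sided units of M, it contains their
one-sided inverses as well and nothing changes ([comp_units_full]).  If Y
contains the units and is bounded by [fFL] or [fFR], the one-sided units of Y(M)
are the units of M ([comp_units_finite]).  The reason is that when a product of
generators is a right unit, the first generator is a right unit; a right unit
that is idempotent is 1, and one that is a left unit is a unit, so that the
first generator can be cancelled and the next one treated in the same way
([right_unit_generated], and dually [left_unit_generated]).  If Y is bounded by
[fE], the only one-sided unit of Y(M) is 1 ([comp_units_E]).  These cases cover
all listed Y ([E_cases], [units_cases]), and composition becomes a computation
on names ([interp_comp]).

The functors are distinct because the containments between them are exactly
those generated by an explicit list ([interp_sub]).  By the table and by the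
facts on one-sided units, a further containment would force one among
[fG] <= [fO], [fQ] <= [fO], [fGL] <= [fG], [fGR] <= [fG] and [fI] <= [fFLR].
The first four fail in the monoid of self-maps of the naturals, by the exchange
of 0 and 1 and by the pair pred o succ = 1, succ o pred <> 1; the last fails in
the additive naturals.

A composite A o Y o B is bounded by Y.  Hence the J-order is contained in the
containment order ([leJ_sub]), which gives J-triviality.  It is strictly
smaller: [fGL] is bounded by [fPL], but not below it in the J-order.  What
remains is a computation in a monoid with fifteen elements. *)

(** * Containment of functors and composition *)

Definition subF (X Y : subfunctor) : Prop :=
  forall (M : monoidType) (x : M), carrier (X M) x -> carrier (Y M) x.

Lemma subF_refl X : subF X X.
Proof. by []. Qed.

Lemma subF_trans X Y Z : subF X Y -> subF Y Z -> subF X Z.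
Proof. by move=> XY YZ M x /XY/YZ. Qed.

Lemma subF_anti X Y : subF X Y -> subF Y X -> X = Y.
Proof. by move=> XY YX; apply/subfunctorP => M x; split=> [/XY|/YX]. Qed.

Lemma sub_O X : subF fO X.
Proof. by move=> M x ->; have [] := carrierP (X M). Qed.

Lemma sub_I X : subF X fI.
Proof. by []. Qed.

Lemma emb_morphism (M : monoidType) (A : submonoid M) :
  monoid_morphism (@emb M A).
Proof. by split=> [|x y]; [apply: emb1|apply: embM]. Qed.

(** The inclusion of Y(M) in M is a homomorphism, so X maps X(Y(M)) into X(M). *)
Lemma comp_subl X Y : subF (X \oF Y) X.
Proof.
move=> M _ [y Xy <-]; exact: (functor_sub (emb_morphism (Y M)) Xy).
Qed.

Lemma comp_subr X Y : subF (X \oF Y) Y.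
Proof. by move=> M _ [y _ <-]; apply: embP. Qed.

Lemma compIF Y : fI \oF Y = Y.
Proof.
apply: subF_anti; first exact: comp_subr.
by move=> M x Yx; exists (to_sub Yx).
Qed.

Lemma comp_monol X X' Y : subF X X' -> subF (X \oF Y) (X' \oF Y).
Proof. by move=> XX' M _ [y Xy <-]; exists y => //; apply: XX'. Qed.

(** The inclusion of Y(M) in Y'(M) is a homomorphism, preserved by X. *)
Lemma comp_monor X Y Y' : subF Y Y' -> subF (X \oF Y) (X \oF Y').
Proof.
move=> YY' M _ [y Xy <-].
pose f (v : monoid_of (Y M)) := to_sub (YY' _ _ (embP v)).
have embf v : emb (f v) = emb v by [].
have f_morph : monoid_morphism f.
  by split=> [|v w]; apply: emb_inj; rewrite ?embM !embf ?emb1 ?embM.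
by exists (f y) => //; apply: (functor_sub f_morph Xy).
Qed.

(** (Y o Z)(M), a submonoid of M, and Y(Z(M)), a submonoid of the monoid Z(M),
are isomorphic monoids over M; X preserves both isomorphisms. *)
Lemma compA X Y Z : X \oF (Y \oF Z) = (X \oF Y) \oF Z.
Proof.
apply: subF_anti => M x [].
  move=> u Xu <-.
  (* f is the isomorphism from (Y o Z)(M) onto Y(Z(M)). *)
  have in_Z (v : monoid_of ((Y \oF Z) M)) : carrier (Z M) (emb v).
    exact/comp_subr/embP.
  have in_Y (v : monoid_of ((Y \oF Z) M)) : carrier (Y _) (to_sub (in_Z v)).
    by have [w Yw ew] := embP v; rewrite (_ : to_sub _ = w) //; apply: emb_inj.
  pose f v : monoid_of (Y (monoid_of (Z M))) := to_sub (in_Y v).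
  have f_morph : monoid_morphism f.
    have embf v : emb (emb (f v)) = emb v by [].
    split; first by do 2!apply: emb_inj; rewrite embf !emb1.
    by move=> v w; do 2!apply: emb_inj; rewrite !(embf, embM).
  exists (emb (f u)) => //; exists (f u) => //.
  exact: (functor_sub f_morph Xu).
move=> _ [u Xu <-] <-.
have in_YZ (v : monoid_of (Y (monoid_of (Z M)))) : carrier ((Y \oF Z) M) (emb (emb v)).
  by exists (emb v) => //; apply: embP.
pose f v : monoid_of ((Y \oF Z) M) := to_sub (in_YZ v).
have f_morph : monoid_morphism f.
  have embf v : emb (f v) = emb (emb v) by [].
  split; first by apply: emb_inj; rewrite embf !emb1.
  by move=> v w; apply: emb_inj; rewrite !(embf, embM).
by exists (f u) => //; apply: (functor_sub f_morph Xu).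
Qed.

(** * Joins *)

Lemma generated_min (T : Type) (op : T -> T -> T) (e : T) (A B : T -> Prop) :
  (forall x, A x -> generated op e B x) ->
  forall x, generated op e A x -> generated op e B x.
Proof. by move=> AB x; apply; first exact: generated_closed. Qed.

Lemma union_functor (X Y : subfunctor) (M N : monoidType) (f : M -> N) :
  monoid_morphism f ->
  forall x, (X M `|` Y M) x -> (X N `|` Y N) (f x).
Proof. by move=> hf x [h|h]; [left|right]; apply: (functor_sub hf). Qed.

Definition join (X Y : subfunctor) : subfunctor := genF (@union_functor X Y).

Lemma sub_joinl X Y : subF X (join X Y).
Proof. by move=> M x Xx; apply: generated_sub; left. Qed.

Lemma sub_joinr X Y : subF Y (join X Y).
Proof. by move=> M x Yx; apply: generated_sub; right. Qed.

Lemma join_lub X Y Z : subF X Z -> subF Y Z -> subF (join X Y) Z.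
Proof.
move=> XZ YZ M x; apply; first exact: carrierP.
by move=> y [/XZ|/YZ].
Qed.

Lemma join_mono X X' Y Y' :
  subF X X' -> subF Y Y' -> subF (join X Y) (join X' Y').
Proof.
move=> XX' YY'; apply: join_lub.
  exact: subF_trans XX' (@sub_joinl _ _).
exact: subF_trans YY' (@sub_joinr _ _).
Qed.

Lemma join_absorb X Y : subF X Y -> join X Y = Y.
Proof.
move=> XY; apply: subF_anti; last exact: sub_joinr.
exact: join_lub.
Qed.

Lemma joinXO X : join X fO = X.
Proof.
apply: subF_anti; last exact: sub_joinl.
by apply: join_lub => //; apply: sub_O.
Qed.

Lemma comp_genP (A : forall M : monoidType, set M)
    (hA : forall (M N : monoidType) (f : M -> N), monoid_morphism f ->
       forall x, A M x -> A N (f x)) (Y : subfunctor) (M : monoidType) (x : M) :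
  carrier ((genF hA \oF Y) M) x <->
  generated (@mul M) 1 (@emb M (Y M) @` A (monoid_of (Y M))) x.
Proof.
split=> [[u gu <-]|].
  apply: (gu (fun v => generated _ _ _ (emb v))); last first.
    by move=> v Av; apply: generated_sub; exists v.
  have [g1 gM] := generated_closed (@mul M) 1
    (@emb M (Y M) @` A (monoid_of (Y M))).
  by split=> [|v w gv gw]; rewrite ?emb1 ?embM //; apply: gM.
apply; first exact: carrierP.
by move=> _ [v Av <-]; exists v => //; apply: generated_sub.
Qed.

(** Both sides are generated by the images of X(Y(M)) and X'(Y(M)). *)
Lemma comp_join X X' Y : join X X' \oF Y = join (X \oF Y) (X' \oF Y).
Proof. by apply/subfunctorP => M x; rewrite comp_genP image_setU. Qed.

Lemma fF_join : fF = join fE fG.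
Proof. by apply/subfunctorP => M x; split. Qed.

Lemma fFL_join : fFL = join fE fGL.
Proof. by apply/subfunctorP => M x; split. Qed.

Lemma fFR_join : fFR = join fE fGR.
Proof. by apply/subfunctorP => M x; split. Qed.

Lemma fGLR_join : fGLR = join fGL fGR.
Proof. by apply/subfunctorP => M x; split. Qed.

Lemma fFLR_join : fFLR = join fE fGLR.
Proof.
rewrite fGLR_join; apply/subfunctorP => M x; split.
  apply: generated_min => y [[Ey|Ly]|Ry].
  - exact: sub_joinl.
  - by apply: sub_joinr; apply: sub_joinl.
  - by apply: sub_joinr; apply: sub_joinr.
apply; first exact: carrierP.
move=> y [Ey|]; first by apply: generated_sub; left; left.
by apply: generated_min => z [Lz|Rz]; apply: generated_sub; [left; right|right].
Qed.

(** * Idempotents of Y(M) *)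

Lemma compEP (Y : subfunctor) (M : monoidType) (x : M) :
  carrier ((fE \oF Y) M) x <->
  generated (@mul M) 1 [set y | carrier (Y M) y /\ y * y = y] x.
Proof.
rewrite comp_genP; set A := _ @` _; set B := [set y | _].
suff -> : A = B by [].
apply/seteqP; split=> [_ [v ev <-]|y [Yy ey]] /=.
  by split; [apply: embP|rewrite -embM ev].
by exists (to_sub Yy) => //; apply: emb_inj; rewrite embM.
Qed.

(** * One-sided units of Y(M) *)

Lemma compGLP (Y : subfunctor) (M : monoidType) (x : M) :
  carrier ((fGL \oF Y) M) x <-> carrier (Y M) x /\ exists2 a, carrier (Y M) a & a * x = 1.
Proof.
split=> [[u [v vu] <-]|[Yx [a Ya ax]]].
  by split; [apply: embP|exists (emb v); rewrite -?embM ?vu ?emb1 //; apply: embP].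
by exists (to_sub Yx) => //; exists (to_sub Ya); apply: emb_inj; rewrite embM emb1.
Qed.

Lemma compGRP (Y : subfunctor) (M : monoidType) (x : M) :
  carrier ((fGR \oF Y) M) x <-> carrier (Y M) x /\ exists2 a, carrier (Y M) a & x * a = 1.
Proof.
split=> [[u [v vu] <-]|[Yx [a Ya ax]]].
  by split; [apply: embP|exists (emb v); rewrite -?embM ?vu ?emb1 //; apply: embP].
by exists (to_sub Yx) => //; exists (to_sub Ya); apply: emb_inj; rewrite embM emb1.
Qed.

Lemma compGP (Y : subfunctor) (M : monoidType) (x : M) :
  carrier ((fG \oF Y) M) x <-> carrier ((fGL \oF Y) M) x /\ carrier ((fGR \oF Y) M) x.
Proof.
split=> [[u [Lu Ru] <-]|[[u Lu eu] [v Rv ev]]]; first by split; exists u.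
by exists u => //; split=> //; rewrite (_ : u = v) //; apply: emb_inj; rewrite eu.
Qed.

Lemma E_comp_full Y : subF fE Y -> fE \oF Y = fE.
Proof.
move=> EY; apply: subF_anti; first exact: comp_subl.
move=> M x Ex; apply/compEP; move: x Ex; apply: generated_min => x ex.
by apply: generated_sub; split=> //; apply: EY; apply: generated_sub.
Qed.

Lemma idem_left_unit (M : monoidType) (x : M) :
  x * x = x -> left_units x -> x = 1.
Proof. by move=> xx [a ax]; rewrite -[x]mul1g -ax -mulgA xx. Qed.

Lemma idem_right_unit (M : monoidType) (x : M) :
  x * x = x -> right_units x -> x = 1.
Proof. by move=> xx [a xa]; rewrite -[x]mulg1 -xa mulgA xx. Qed.

Lemma E_comp_units Y : subF Y fGL \/ subF Y fGR -> fE \oF Y = fO.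
Proof.
move=> YG; apply: subF_anti; last exact: sub_O.
move=> M x /compEP; apply; first exact: one_closed.
move=> y [Yy yy]; case: YG => YG; have := YG _ _ Yy.
  exact: idem_left_unit.
exact: idem_right_unit.
Qed.

(** [fE] is idempotent, hence E o Q = Q; the claim follows by monotonicity from
Q = E o Q <= E o Y <= E o GLR = Q. *)
Lemma E_comp_between Y : subF fQ Y -> subF Y fGLR -> fE \oF Y = fQ.
Proof.
move=> QY YG; apply: subF_anti; first exact: comp_monor.
have -> : fQ = fE \oF fQ by rewrite /fQ compA (E_comp_full (@subF_refl fE)).
exact: comp_monor.
Qed.

(** Let H be a submonoid of left units that contains every generator that is a
right unit.  If y z c = 1, then y is a right unit, so y is in H and has a left
inverse d.  Then z c = d and z (c y) = d y = 1, so z is a right unit too. *)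
Lemma right_unit_generated (M : monoidType) (H A : set M) :
  submonoid_closed (@mul M) 1 H -> H `<=` @left_units M ->
  (forall x, A x -> right_units x -> H x) ->
  forall x, generated (@mul M) 1 A x -> right_units x -> H x.
Proof.
move=> [H1 HM] HL AH x gx; apply: (gx (fun x => right_units x -> H x)) => //.
split=> // y z Hy Hz [c yzc].
have Hy' : H y by apply: Hy; exists (z * c); rewrite mulgA.
have [d dy] := HL _ Hy'; apply: HM => //; apply: Hz.
by exists (c * y); rewrite mulgA -[z * c]mul1g -dy -(mulgA d) (mulgA y) yzc mulg1.
Qed.

Lemma left_unit_generated (M : monoidType) (H A : set M) :
  submonoid_closed (@mul M) 1 H -> H `<=` @right_units M ->
  (forall x, A x -> left_units x -> H x) ->
  forall x, generated (@mul M) 1 A x -> left_units x -> H x.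
Proof.
move=> [H1 HM] HR AH x gx; apply: (gx (fun x => left_units x -> H x)) => //.
split=> // y z Hy Hz [c cyz].
have Hz' : H z by apply: Hz; exists (c * y); rewrite -mulgA.
have [d zd] := HR _ Hz'; apply: HM => //; apply: Hy.
exists (z * c); have cy : c * y = d.
  by rewrite -[d]mul1g -cyz -!mulgA zd mulg1.
by rewrite -mulgA cy.
Qed.

Lemma right_unit_E (M : monoidType) (x : M) :
  carrier (fE M) x -> right_units x -> x = 1.
Proof.
apply: (right_unit_generated (H := [set 1]) (A := @idems M)); first exact: one_closed.
  by move=> _ ->; exists 1; rewrite mulg1.
by move=> y; apply: idem_right_unit.
Qed.

Lemma left_unit_E (M : monoidType) (x : M) :
  carrier (fE M) x -> left_units x -> x = 1.
Proof.
apply: (left_unit_generated (H := [set 1]) (A := @idems M)); first exact: one_closed.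
  by move=> _ ->; exists 1; rewrite mulg1.
by move=> y; apply: idem_left_unit.
Qed.

Lemma right_unit_FL (M : monoidType) (x : M) :
  carrier (fFL M) x -> right_units x -> carrier (fG M) x.
Proof.
apply: (right_unit_generated (H := fG M) (A := _ `|` _)); first exact: carrierP.
  by move=> y [].
by move=> y [Ey Ry|//]; rewrite (right_unit_E Ey Ry); apply: sub_O.
Qed.

Lemma left_unit_FR (M : monoidType) (x : M) :
  carrier (fFR M) x -> left_units x -> carrier (fG M) x.
Proof.
apply: (left_unit_generated (H := fG M) (A := _ `|` _)); first exact: carrierP.
  by move=> y [].
by move=> y [Ey Ly|//]; rewrite (left_unit_E Ey Ly); apply: sub_O.
Qed.

(** A unit has no other one-sided inverse than its inverse. *)
Lemma unit_commute (M : monoidType) (a x : M) :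
  a * x = 1 -> carrier (fG M) a \/ carrier (fG M) x -> x * a = 1.
Proof.
move=> ax [[[b ba] _]|[_ [b xb]]].
  have <- : b = x by rewrite -[b]mulg1 -ax mulgA ba mul1g.
  exact: ba.
have -> : a = b by rewrite -[a]mulg1 -xb mulgA ax mul1g.
exact: xb.
Qed.


(** The left inverse of a left unit is a right unit, so it is in Y(M). *)
Lemma comp_units_full Y : subF fGLR Y ->
  [/\ fG \oF Y = fG, fGL \oF Y = fGL, fGR \oF Y = fGR & fGLR \oF Y = fGLR].
Proof.
move=> GY.
have YL M x : carrier (fGL M) x -> carrier (Y M) x.
  by move=> Lx; apply: GY; apply: generated_sub; left.
have YR M x : carrier (fGR M) x -> carrier (Y M) x.
  by move=> Rx; apply: GY; apply: generated_sub; right.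
have eL : fGL \oF Y = fGL.
  apply: subF_anti; first exact: comp_subl.
  move=> M x Lx; apply/compGLP; split; first exact: YL.
  by have [a ax] := Lx; exists a => //; apply: YR; exists x.
have eR : fGR \oF Y = fGR.
  apply: subF_anti; first exact: comp_subl.
  move=> M x Rx; apply/compGRP; split; first exact: YR.
  by have [a xa] := Rx; exists a => //; apply: YL; exists x.
split=> //; last by rewrite fGLR_join comp_join eL eR.
by apply/subfunctorP => M x; rewrite compGP eL eR.
Qed.

Lemma comp_units_eq Y Z :
  fGL \oF Y = Z -> fGR \oF Y = Z -> fG \oF Y = Z /\ fGLR \oF Y = Z.
Proof.
move=> eL eR; split; last by rewrite fGLR_join comp_join eL eR join_absorb.
by apply/subfunctorP => M x; rewrite compGP eL eR; split=> [[]|].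
Qed.

(** If a x = 1 in Y(M), then a is a right unit of FL(M), or x a left unit of
FR(M).  In both cases it is a unit of M, and x a = 1. *)
Lemma comp_units_finite Y : subF fG Y -> subF Y fFL \/ subF Y fFR ->
  [/\ fG \oF Y = fG, fGL \oF Y = fG, fGR \oF Y = fG & fGLR \oF Y = fG].
Proof.
move=> GY YF.
have Yfin (M : monoidType) (a x : M) :
    carrier (Y M) a -> carrier (Y M) x -> a * x = 1 -> x * a = 1.
  move=> Ya Yx ax; apply: (unit_commute ax); case: YF => YF.
    by left; apply: right_unit_FL (YF _ _ Ya) _; exists x.
  by right; apply: left_unit_FR (YF _ _ Yx) _; exists a.
have Yunit (M : monoidType) (x : M) : carrier (fG M) x ->
    carrier (Y M) x /\ exists a, [/\ carrier (Y M) a, a * x = 1 & x * a = 1].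
  move=> Gx; split; first exact: GY.
  have [[a ax] _] := Gx; have xa := unit_commute ax (or_intror Gx).
  by exists a; split=> //; apply: GY; split; exists x.
have eL : fGL \oF Y = fG.
  apply: subF_anti => M x; rewrite compGLP.
    by move=> [Yx [a Ya ax]]; split; exists a => //; apply: Yfin.
  by move=> /Yunit[Yx [a [Ya ax _]]]; split=> //; exists a.
have eR : fGR \oF Y = fG.
  apply: subF_anti => M x; rewrite compGRP.
    by move=> [Yx [a Ya xa]]; split; exists a => //; apply: Yfin.
  by move=> /Yunit[Yx [a [Ya _ xa]]]; split=> //; exists a.
by have [eG eLR] := comp_units_eq eL eR.
Qed.

Lemma comp_units_E Y : subF Y fE ->
  [/\ fG \oF Y = fO, fGL \oF Y = fO, fGR \oF Y = fO & fGLR \oF Y = fO].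
Proof.
move=> YE.
have eL : fGL \oF Y = fO.
  apply: subF_anti (@sub_O _) => M x /compGLP[Yx [a _ ax]].
  by apply: left_unit_E; [apply: YE|exists a].
have eR : fGR \oF Y = fO.
  apply: subF_anti (@sub_O _) => M x /compGRP[Yx [a _ xa]].
  by apply: right_unit_E; [apply: YE|exists a].
by have [eG eLR] := comp_units_eq eL eR.
Qed.

(** * Names of the functors *)

Inductive name := nO | nE | nG | nGL | nGR | nGLR | nF | nFL | nFR | nFLR
  | nQ | nP | nPL | nPR | nI.

Definition names : seq name :=
  [:: nO; nE; nG; nGL; nGR; nGLR; nF; nFL; nFR; nFLR; nQ; nP; nPL; nPR; nI].

Definition rank (x : name) : nat :=
  match x with
  | nO => 0 | nE => 1 | nG => 2 | nGL => 3 | nGR => 4 | nGLR => 5 | nF => 6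
  | nFL => 7 | nFR => 8 | nFLR => 9 | nQ => 10 | nP => 11 | nPL => 12
  | nPR => 13 | nI => 14
  end.

Lemma rankK : cancel rank (nth nI names).
Proof. by case. Qed.

HB.instance Definition _ := Equality.copy name (can_type rankK).

Lemma mem_names x : x \in names.
Proof. by case: x. Qed.

Lemma all_names (p : pred name) : all p names -> forall x, p x.
Proof. by move=> /allP ap x; apply/ap/mem_names. Qed.

Lemma all_names2 (p : rel name) :
  all (fun x => all (p x) names) names -> forall x y, p x y.
Proof. by move=> pp x; apply: all_names; move: x; apply: all_names. Qed.

Definition interp (x : name) : subfunctor :=
  match x with
  | nO => fO | nE => fE | nG => fG | nGL => fGL | nGR => fGR | nGLR => fGLR
  | nF => fF | nFL => fFL | nFR => fFR | nFLR => fFLR | nQ => fQ | nP => fP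
  | nPL => fPL | nPR => fPR | nI => fI
  end.

(** Reachability in at most n steps of the relation with successor lists [up];
chains in the orders below have at most seven elements, so that seven steps
give the reflexive and transitive closure. *)
Fixpoint reach (up : name -> seq name) (n : nat) (x y : name) : bool :=
  (x == y) || (if n is m.+1 then has (reach up m ^~ y) (up x) else false).

(** Containment between functors that holds in all monoids, upper covers only.
It contains [fGL] <= [fPL] and [fGR] <= [fPR], which fail in the J-order. *)
Definition sub_covers (x : name) : seq name :=
  match x with
  | nO => [:: nG; nQ] | nQ => [:: nE; nP] | nE => [:: nF]
  | nG => [:: nGL; nGR; nP] | nGL => [:: nPL] | nGR => [:: nPR]
  | nP => [:: nPL; nPR; nF] | nPL => [:: nGLR; nFL] | nPR => [:: nGLR; nFR]
  | nF => [:: nFL; nFR] | nFL | nFR | nGLR => [:: nFLR] | nFLR => [:: nI]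
  | nI => [::]
  end.

Definition le : rel name := reach sub_covers 7.

Definition epart (x : name) : name :=
  match x with
  | nE | nF | nFL | nFR | nFLR => nE
  | nQ | nP | nPL | nPR => nQ
  | _ => nO
  end.

Definition gpart (x : name) : name :=
  match x with
  | nG | nF | nP => nG
  | nGL | nFL | nPL => nGL
  | nGR | nFR | nPR => nGR
  | nGLR | nFLR => nGLR
  | _ => nO
  end.

(** Name of the join of an idempotent part and a unit part.  The pair of [fQ]
and [fGLR] is the only one that collapses, since Q(M) lies in GLR(M). *)
Definition glue (e g : name) : name :=
  match e, g with
  | nE, nG => nF | nE, nGL => nFL | nE, nGR => nFR | nE, nGLR => nFLR
  | nE, _ => nE
  | nQ, nG => nP | nQ, nGL => nPL | nQ, nGR => nPR | nQ, nGLR => nGLR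
  | nQ, _ => nQ
  | _, _ => g
  end.

(** Composites of [fO], [fE] and [fQ] with y; the last case is Q o y =
E o (GLR o y). *)
Definition ecomp (e y : name) : name :=
  match e with
  | nE => if le nE y then nE else if le y nGL || le y nGR then nO else nQ
  | nQ => if le nGLR y then nQ else nO
  | _ => nO
  end.

Definition gcomp (g y : name) : name :=
  if le nGLR y then g else if (g == nO) || le y nE then nO else nG.

Definition comp (x y : name) : name :=
  if x is nI then y else glue (ecomp (epart x) y) (gcomp (gpart x) y).

(** * The composition table *)

Lemma fP_join : fP = join fQ fG.
Proof.
rewrite /fP fF_join comp_join.
by have [-> _ _ _] := comp_units_full (@subF_refl fGLR).
Qed.

Lemma fPL_join : fPL = join fQ fGL.
Proof.
rewrite /fPL fFL_join comp_join.
by have [_ -> _ _] := comp_units_full (@subF_refl fGLR).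
Qed.

Lemma fPR_join : fPR = join fQ fGR.
Proof.
rewrite /fPR fFR_join comp_join.
by have [_ _ -> _] := comp_units_full (@subF_refl fGLR).
Qed.

Lemma sub_coversP x y : y \in sub_covers x -> subF (interp x) (interp y).
Proof.
have subG_GL : subF fG fGL by move=> M z [].
have subG_GR : subF fG fGR by move=> M z [].
case: x; case: y => // _ /=;
  first [ exact: sub_O | exact: sub_I | exact: comp_subl | exact: comp_subr
        | rewrite ?(fP_join, fPL_join, fPR_join, fFLR_join, fGLR_join,
                    fF_join, fFL_join, fFR_join);
          first [ exact: sub_joinl | exact: sub_joinr
                | by apply: join_mono => //; apply: sub_joinl
                | by apply: join_mono => //; apply: sub_joinr
                | by apply: join_mono ] ].
Qed.

Lemma sub_le x y : le x y -> subF (interp x) (interp y).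
Proof.
rewrite /le; elim: 7 x => [|n IHn] x /= /orP[/eqP->|] //.
by move=> /hasP[z /sub_coversP xz /IHn]; apply: subF_trans.
Qed.

Lemma join_interp e g : e \in [:: nO; nE; nQ] ->
  g \in [:: nO; nG; nGL; nGR; nGLR] ->
  join (interp e) (interp g) = interp (glue e g).
Proof.
case: e => // _; case: g => // _ /=; rewrite ?joinXO ?(join_absorb (@sub_O _)) //.
all: rewrite ?(fP_join, fPL_join, fPR_join, fF_join, fFL_join, fFR_join) -?fFLR_join //.
exact/join_absorb/comp_subr.
Qed.

Lemma split_interp x : x != nI ->
  interp x = join (interp (epart x)) (interp (gpart x)).
Proof. by rewrite join_interp; case: x. Qed.

Lemma E_cases y :
  [|| le nE y, le y nGL || le y nGR | le nQ y && le y nGLR].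
Proof. by move: y; apply: all_names; vm_compute. Qed.

Lemma units_cases y :
  [|| le nGLR y, le y nE | le nG y && (le y nFL || le y nFR)].
Proof. by move: y; apply: all_names; vm_compute. Qed.

Lemma interp_gcomp g y : g \in [:: nO; nG; nGL; nGR; nGLR] ->
  interp g \oF interp y = interp (gcomp g y).
Proof.
rewrite inE; have [-> _|g_nO /= gK] := eqVneq g nO.
  rewrite /gcomp /= if_same.
  exact/subF_anti/sub_O/comp_subl.
rewrite /gcomp (negPf g_nO) /=; have := units_cases y.
have [/sub_le GLRy _|_] := boolP (le nGLR y).
  have [eG eL eR eLR] := comp_units_full GLRy.
  by case: g gK {g_nO} => //=.
have [/sub_le yE _|_ /= /andP[/sub_le Gy yF]] := boolP (le y nE).
  have [eG eL eR eLR] := comp_units_E yE.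
  by case: g gK {g_nO} => //=.
have [|eG eL eR eLR] := comp_units_finite Gy; last by case: g gK {g_nO} => //=.
by have [/sub_le|/sub_le] := orP yF; [left|right].
Qed.

Lemma interp_ecomp e y : e \in [:: nO; nE; nQ] ->
  interp e \oF interp y = interp (ecomp e y).
Proof.
have interp_E z : fE \oF interp z = interp (ecomp nE z).
  rewrite /ecomp; have := E_cases z.
  have [/sub_le Ez _|_] := boolP (le nE z); first exact: E_comp_full.
  have [zLR _|_ /= /andP[/sub_le Qz /sub_le zG]] := boolP (le z nGL || le z nGR).
    by apply: E_comp_units; have [/sub_le|/sub_le] := orP zLR; [left|right].
  exact: E_comp_between.
rewrite !inE => /or3P[] /eqP-> //=.
  exact/subF_anti/sub_O/comp_subl.
rewrite /fQ -compA (@interp_gcomp nGLR) // interp_E.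
by case: y.
Qed.

Lemma interp_comp x y : interp x \oF interp y = interp (comp x y).
Proof.
have [->|x_nI] := eqVneq x nI; first exact: compIF.
have -> : comp x y = glue (ecomp (epart x) y) (gcomp (gpart x) y) by case: x x_nI.
rewrite split_interp // comp_join interp_ecomp; last by case: x {x_nI}.
rewrite interp_gcomp; last by case: x {x_nI}.
by apply: join_interp; case: x {x_nI}; case: y.
Qed.

(** * Distinctness *)

(** The self-maps of the naturals under composition.  The separate name carries
the monoid structure. *)
Definition self_map : Type := nat -> nat.

HB.instance Definition _ := Choice.on self_map.

Fact self_map_compA : associative (fun f g : self_map => f \o g : self_map).
Proof. by []. Qed.

Fact self_map_comp1f :
  left_id (id : self_map) (fun f g : self_map => f \o g : self_map).
Proof. by []. Qed.

Fact self_map_compf1 :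
  right_id (id : self_map) (fun f g : self_map => f \o g : self_map).
Proof. by []. Qed.

HB.instance Definition _ :=
  isMonoid.Build self_map self_map_compA self_map_comp1f self_map_compf1.

Lemma succ_pred : (succn : self_map) * (predn : self_map) <> 1.
Proof. by move=> /(congr1 (@^~ 0)). Qed.

Lemma GL_not_G : ~ subF fGL fG.
Proof.
move=> LG; have [|_ [g sg]] := LG self_map succn; first by exists predn.
by have := congr1 (@^~ 0) sg.
Qed.

Lemma GR_not_G : ~ subF fGR fG.
Proof.
move=> RG; have [|[g gp] _] := RG self_map predn; first by exists succn.
have gpE n : g n.-1 = n by rewrite -[LHS]/((g * predn : self_map) n) gp.
by have := gpE 1%N; rewrite (gpE 0).
Qed.

Lemma Q_not_O : ~ subF fQ fO.
Proof.
move=> QO; apply: succ_pred; apply: QO; apply/compEP; apply: generated_sub.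
split; last by [].
have [_ GM] := carrierP (fGLR self_map).
apply: GM; apply: generated_sub; [left|right].
  by exists predn.
by exists succn.
Qed.

Definition swap01 : self_map :=
  fun n => match n with 0 => 1%N | 1 => 0 | _ => n end.

Lemma G_not_O : ~ subF fG fO.
Proof.
move=> GO; have swap2 : (swap01 : self_map) * swap01 = 1.
  by apply: funext => -[|[]].
have swap1 : swap01 = 1 :> self_map by apply: GO; split; exists swap01.
by have := congr1 (@^~ 0) swap1.
Qed.

(** In the additive naturals 0 is the only idempotent and the only one-sided
unit. *)
Lemma I_not_FLR : ~ subF fI fFLR.
Proof.
pose N : monoidType := Algebra.to_multiplicative nat.
have N1 (x y : N) : x * y = 1 -> x = 1 /\ y = 1.
  by case: x y => [|x] [].
move=> /(_ N 1%N I) F1; suff : (1%N : N) = 1 by [].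
apply: (F1 (eq^~ 1)); first exact: one_closed.
move=> x [[Ex|[a /N1[]//]]|[a /N1[]//]].
apply: (Ex (eq^~ 1)); first exact: one_closed.
case=> [|n] // nn; have : (n.+1 + n.+1)%N = n.+1 by exact: nn.
by move=> /eqP; rewrite -[X in _ == X]addn0 eqn_add2l.
Qed.

(** Seven containments that fail.  Any two names x, y with x not below y in [le]
have a listed pair (u, v) with u below x and y below v. *)
Definition separating : seq (name * name) :=
  [:: (nG, nE); (nI, nFLR); (nE, nGLR); (nQ, nGL); (nQ, nGR); (nGL, nFR); (nGR, nFL)].

(** Composing a containment with [fG] or [fE], on the right or on the left,
reduces it to one of the five basic failures; for [fGL] <= [fFR], use that left
units of FR(M) are units. *)
Lemma not_sub_separating x y :
  (x, y) \in separating -> ~ subF (interp x) (interp y).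
Proof.
rewrite !inE => /or4P[||| /or4P[]] /eqP[-> ->] /= xy.
- apply: G_not_O; have := comp_monol (Y := fG) xy.
  by rewrite (@interp_comp nG nG) (@interp_comp nE nG).
- exact: I_not_FLR xy.
- apply: Q_not_O; apply: (subF_trans (@sub_le nQ nE isT)).
  have := comp_monol (Y := fE) xy.
  by rewrite (@interp_comp nE nE) (@interp_comp nGLR nE).
- apply: Q_not_O; have := comp_monor (X := fE) xy.
  by rewrite (@interp_comp nE nQ) (@interp_comp nE nGL).
- apply: Q_not_O; have := comp_monor (X := fE) xy.
  by rewrite (@interp_comp nE nQ) (@interp_comp nE nGR).
- by apply: GL_not_G => M z Lz; apply: left_unit_FR => //; apply: xy.
- by apply: GR_not_G => M z Rz; apply: right_unit_FL => //; apply: xy.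
Qed.

Lemma interp_sub x y : subF (interp x) (interp y) <-> le x y.
Proof.
split=> [xy|]; last exact: sub_le.
have : le x y || has (fun p => le p.1 x && le y p.2) separating.
  by move: x y {xy}; apply: all_names2; vm_compute.
have [//|_ /hasP[[u v] uv /andP[/= ux yv]]] := boolP (le x y).
exfalso; apply: (not_sub_separating uv).
exact: subF_trans (sub_le ux) (subF_trans xy (sub_le yv)).
Qed.

Lemma le_anti x y : le x y && le y x ==> (x == y).
Proof. by move: x y; apply: all_names2; vm_compute. Qed.

Lemma interp_inj x y : interp x = interp y -> x = y.
Proof.
move=> exy; apply/eqP/(implyP (le_anti x y))/andP.
by split; apply/interp_sub; rewrite exy.
Qed.

(** * The J-order *)

Definition interps (l : seq name) : seq subfunctor := List.map interp l.

Lemma In_interps X l :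
  List.In X (interps l) <-> exists2 x, x \in l & X = interp x.
Proof.
elim: l => [|x l IHl] /=; first by split=> [[]|[]].
rewrite IHl; split=> [[<-|[y ly ->]]|[y]].
- by exists x => //; apply: mem_head.
- by exists y => //; rewrite inE ly orbT.
by rewrite inE => /predU1P[->|ly] ->; [left|right; exists y].
Qed.

Lemma interps_ind (P : subfunctor -> Prop) l :
  (forall x, x \in l -> P (interp x)) -> forall X, List.In X (interps l) -> P X.
Proof. by move=> lP X /In_interps[x lx ->]; apply: lP. Qed.

Lemma NoDup_interps l : uniq l -> List.NoDup (interps l).
Proof.
elim: l => [|x l IHl] /=; first by constructor.
move=> /andP[lx /IHl ul]; constructor=> // /In_interps[y ly /interp_inj xy].
by rewrite xy ly in lx.
Qed.

Lemma FplusP X : Fplus X <-> exists x, X = interp x.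
Proof.
split=> [/(@In_interps X names)[x _ ->]|[x ->]]; first by exists x.
by apply/(@In_interps _ names); exists x => //; apply: mem_names.
Qed.

Lemma Fplus_interp x : Fplus (interp x).
Proof. by apply/FplusP; exists x. Qed.

Lemma table_row x l z : all (fun y => comp x y == z) l ->
  forall Y, List.In Y (interps l) -> interp x \oF Y = interp z.
Proof.
move=> /allP xlz; apply: interps_ind => y /xlz /eqP <-; exact: interp_comp.
Qed.

Definition covering_pairs : seq (name * name) :=
  [:: (nO, nG); (nO, nQ); (nQ, nE); (nQ, nP); (nE, nF); (nG, nGL);
      (nG, nGR); (nG, nP); (nP, nPL); (nP, nPR); (nP, nF); (nGL, nGLR);
      (nGR, nGLR); (nPL, nGLR); (nPR, nGLR); (nPL, nFL); (nPR, nFR);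
      (nF, nFL); (nF, nFR); (nFL, nFLR); (nFR, nFLR); (nGLR, nFLR);
      (nFLR, nI)].

Definition J_covers (x : name) : seq name :=
  [seq p.2 | p <- covering_pairs & p.1 == x].

Definition Jle : rel name := reach J_covers 7.

(** Composites a o y o b are enumerated over the fifteen names a and b. *)
Lemma leJ_interp x y : leJ compF Fplus (interp x) (interp y) <-> Jle x y.
Proof.
have -> : Jle x y = has (fun a => has (fun b => x == comp (comp a y) b) names) names.
  by apply/eqP; move: x y; apply: all_names2; vm_compute.
split=> [[_ [_ [/FplusP[a ->] /FplusP[b ->]]]]|].
  rewrite !interp_comp => /interp_inj exy.
  apply/hasP; exists a; rewrite ?mem_names //.
  by apply/hasP; exists b; rewrite ?mem_names ?exy.
move=> /hasP[a _ /hasP[b _ /eqP->]].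
exists (interp a), (interp b); split; try exact: Fplus_interp.
by rewrite !interp_comp.
Qed.

(** (A o Y) o B <= A o Y <= Y. *)
Lemma leJ_sub (S : subfunctor -> Prop) X Y : leJ compF S X Y -> subF X Y.
Proof.
by move=> [A [B [_ _ ->]]]; apply: subF_trans (@comp_subl _ _) (@comp_subr _ _).
Qed.

Definition Jlt x y := Jle x y && (x != y).

Lemma ltJ_interp x y : ltJ compF Fplus (interp x) (interp y) <-> Jlt x y.
Proof.
rewrite /ltJ leJ_interp; split=> [[xy nxy]|/andP[xy /eqP nxy]].
  by apply/andP; split=> //; apply/eqP => exy; apply: nxy; rewrite exy.
by split=> // /interp_inj.
Qed.

Lemma coversJ_interp x y :
  coversJ compF Fplus (interp x) (interp y) <-> y \in J_covers x.
Proof.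
have -> : (y \in J_covers x) =
    Jlt x y && ~~ has (fun z => Jlt x z && Jlt z y) names.
  by apply/eqP; move: x y; apply: all_names2; vm_compute.
split=> [[_ _ /ltJ_interp -> nz]|/andP[/ltJ_interp xy /hasP nz]].
  apply/hasP => -[z _ /andP[/ltJ_interp xz /ltJ_interp zy]].
  by apply: nz; exists (interp z); split=> //; apply: Fplus_interp.
split=> //; try exact: Fplus_interp.
move=> [_ [/FplusP[z ->] /ltJ_interp xz /ltJ_interp zy]].
by apply: nz; exists z; rewrite ?mem_names ?xz.
Qed.

Definition interp_pairs (l : seq (name * name)) : seq (subfunctor * subfunctor) :=
  List.map (fun p => (interp p.1, interp p.2)) l.

Lemma In_interp_pairs X Y l : List.In (X, Y) (interp_pairs l) <->
  exists x y, [/\ (x, y) \in l, X = interp x & Y = interp y].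
Proof.
elim: l => [|[u v] l IHl] /=; first by split=> [[]|[x [y []]]].
rewrite IHl; split=> [[[<- <-]|[x [y [xy -> ->]]]]|[x [y [+ -> ->]]]].
- by exists u, v; rewrite mem_head.
- by exists x, y; rewrite inE xy orbT.
by rewrite inE => /predU1P[[-> ->]|xy]; [left|right; exists x, y].
Qed.

(** * Idempotents and coverings *)

Definition idempotent_names : seq name := [:: nO; nE; nG; nGLR; nF; nFLR; nI].

Lemma idempotent_interp x :
  idempotent_elt compF (interp x) <-> x \in idempotent_names.
Proof.
have -> : (x \in idempotent_names) = (comp x x == x).
  by apply/eqP; move: x; apply: all_names; vm_compute.
rewrite /idempotent_elt interp_comp; split=> [/interp_inj/eqP //|/eqP -> //].
Qed.

Lemma idempotents X : Fplus X /\ idempotent_elt compF X <->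
  List.In X (interps idempotent_names).
Proof.
rewrite In_interps; split=> [[/FplusP[x ->] /idempotent_interp ix]|[x ix ->]].
  by exists x.
by split; [apply: Fplus_interp|apply/idempotent_interp].
Qed.

(** The right-hand list consists of the products of two idempotents; besides
the idempotents it has only Q = E o GLR and P = F o GLR. *)
Lemma idempotent_generated X :
  generated compF fI (fun Y => Fplus Y /\ idempotent_elt compF Y) X <->
  List.In X (interps [:: nO; nE; nG; nGLR; nF; nFLR; nQ; nP; nI]).
Proof.
set S := [:: nO; nE; nG; nGLR; nF; nFLR; nQ; nP; nI].
set gen := generated _ _ _.
have [_ genM] : submonoid_closed compF fI gen by exact: generated_closed.
have gen_idem x : x \in idempotent_names -> gen (interp x).
  by move=> ix; apply: generated_sub; apply/idempotents/In_interps; exists x.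
split=> [gX|].
  apply: (gX (fun Y => List.In Y (interps S))); last first.
    move=> Y /idempotents/In_interps[y iy ->]; apply/In_interps; exists y => //.
    by move: y iy; apply/allP; vm_compute.
  split; first by apply/In_interps; exists nI.
  move=> _ _ /In_interps[x Sx ->] /In_interps[y Sy ->]; rewrite interp_comp.
  apply/In_interps; exists (comp x y) => //; move: y Sy; apply/allP.
  by move: x Sx; apply/allP; vm_compute.
move: X; apply: interps_ind => x Sx.
have /hasP[a ia /hasP[b ib /eqP->]] :
    has (fun a => has (fun b => x == comp a b) idempotent_names) idempotent_names.
  by move: x Sx; apply/allP; vm_compute.
by rewrite -interp_comp; apply: genM; apply: gen_idem.
Qed.

Lemma coverings X Y :
  coversJ compF Fplus X Y <-> List.In (X, Y) (interp_pairs covering_pairs).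
Proof.
have pairsE x y : (y \in J_covers x) = ((x, y) \in covering_pairs).
  by apply/eqP; move: x y; apply: all_names2; vm_compute.
rewrite In_interp_pairs; split=> [XY|[x [y [xy -> ->]]]].
  have [/FplusP[x eX] /FplusP[y eY] _ _] := XY; exists x, y; split=> //.
  by rewrite -pairsE; apply/coversJ_interp; rewrite -eX -eY.
by apply/coversJ_interp; rewrite pairsE.
Qed.

Theorem mainTheorem3 :
  (* the fifteen listed functors are pairwise distinct *)
  List.NoDup Fplus_seq /\
  (* closure under composition; monoid with identity fI *)
  (forall X Y, Fplus X -> Fplus Y -> Fplus (X \oF Y)) /\
  (forall X Y Z, Fplus X -> Fplus Y -> Fplus Z ->
     X \oF (Y \oF Z) = (X \oF Y) \oF Z) /\
  Fplus fI /\
  (forall X, Fplus X -> fI \oF X = X /\ X \oF fI = X) /\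
  (* composition table *)
  (forall Y, Fplus Y -> fO \oF Y = fO) /\
  [/\ forall Y, List.In Y [:: fO; fG; fGL; fGR] -> fE \oF Y = fO,
      forall Y, List.In Y [:: fE; fF; fFL; fFR; fFLR; fI] -> fE \oF Y = fE &
      forall Y, List.In Y [:: fGLR; fQ; fP; fPL; fPR] -> fE \oF Y = fQ] /\
  (forall X, List.In X [:: fG; fGL; fGR; fGLR; fP; fPL; fPR] ->
     [/\ forall Y, List.In Y [:: fO; fE; fQ] -> X \oF Y = fO,
         forall Y, List.In Y [:: fGLR; fFLR; fI] -> X \oF Y = X &
         forall Y, List.In Y [:: fG; fGL; fGR; fF; fFL; fFR; fP; fPL; fPR] ->
           X \oF Y = fG]) /\
  (forall X, List.In X [:: fF; fFL; fFR; fFLR] ->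
     [/\ X \oF fO = fO, X \oF fE = fE & X \oF fQ = fQ] /\
     [/\ forall Y, List.In Y [:: fG; fGL; fGR] -> X \oF Y = fG,
         forall Y, List.In Y [:: fF; fFL; fFR] -> X \oF Y = fF,
         forall Y, List.In Y [:: fP; fPL; fPR] -> X \oF Y = fP &
         forall Y, List.In Y [:: fFLR; fI] -> X \oF Y = X]) /\
  [/\ fF \oF fGLR = fP, fFL \oF fGLR = fPL, fFR \oF fGLR = fPR &
      fFLR \oF fGLR = fGLR] /\
  (forall Y, List.In Y [:: fGLR; fFLR; fI] -> fQ \oF Y = fQ) /\
  (forall Y, Fplus Y -> ~ List.In Y [:: fGLR; fFLR; fI] -> fQ \oF Y = fO) /\
  (* J-triviality *)
  (forall X Y, Fplus X -> Fplus Y -> eqJ compF Fplus X Y -> X = Y) /\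
  (* idempotents and the submonoid they generate *)
  (forall X, Fplus X /\ idempotent_elt compF X <->
     List.In X [:: fO; fE; fG; fGLR; fF; fFLR; fI]) /\
  (forall X,
     generated compF fI (fun Y => Fplus Y /\ idempotent_elt compF Y) X <->
     List.In X [:: fO; fE; fG; fGLR; fF; fFLR; fQ; fP; fI]) /\
  (* covering relations of the J-order, smaller element first *)
  (forall X Y, coversJ compF Fplus X Y <->
     List.In (X, Y)
       [:: (fO, fG); (fO, fQ); (fQ, fE); (fQ, fP); (fE, fF); (fG, fGL);
           (fG, fGR); (fG, fP); (fP, fPL); (fP, fPR); (fP, fF); (fGL, fGLR);
           (fGR, fGLR); (fPL, fGLR); (fPR, fGLR); (fPL, fFL); (fPR, fFR);
           (fF, fFL); (fF, fFR); (fFL, fFLR); (fFR, fFLR); (fGLR, fFLR);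
           (fFLR, fI)]).
Proof.
split; first exact: (@NoDup_interps names).
split.
  by move=> _ _ /FplusP[x ->] /FplusP[y ->]; rewrite interp_comp; apply: Fplus_interp.
split; first by move=> *; apply: compA.
split; first exact: (Fplus_interp nI).
split.
  move=> _ /FplusP[x ->]; split; first exact: compIF.
  by rewrite (interp_comp x nI); case: x.
split; first exact: (@table_row nO names nO).
split.
  split.
  - exact: (@table_row nE [:: nO; nG; nGL; nGR] nO).
  - exact: (@table_row nE [:: nE; nF; nFL; nFR; nFLR; nI] nE).
  - exact: (@table_row nE [:: nGLR; nQ; nP; nPL; nPR] nQ).
split.
  apply: (@interps_ind _ [:: nG; nGL; nGR; nGLR; nP; nPL; nPR]) => x lx; split.
  - apply: (@table_row x [:: nO; nE; nQ] nO).
    by move: x lx; apply/allP; vm_compute.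
  - apply: (@table_row x [:: nGLR; nFLR; nI] x).
    by move: x lx; apply/allP; vm_compute.
  - apply: (@table_row x [:: nG; nGL; nGR; nF; nFL; nFR; nP; nPL; nPR] nG).
    by move: x lx; apply/allP; vm_compute.
split.
  apply: (@interps_ind _ [:: nF; nFL; nFR; nFLR]) => x lx; split; split.
  - by rewrite (interp_comp x nO); case: x lx.
  - by rewrite (interp_comp x nE); move: x lx; case.
  - by rewrite (interp_comp x nQ); move: x lx; case.
  - apply: (@table_row x [:: nG; nGL; nGR] nG).
    by move: x lx; apply/allP; vm_compute.
  - apply: (@table_row x [:: nF; nFL; nFR] nF).
    by move: x lx; apply/allP; vm_compute.
  - apply: (@table_row x [:: nP; nPL; nPR] nP).
    by move: x lx; apply/allP; vm_compute.
  - apply: (@table_row x [:: nFLR; nI] x).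
    by move: x lx; apply/allP; vm_compute.
split; first by split=> //; exact: (interp_comp nFLR nGLR).
split; first exact: (@table_row nQ [:: nGLR; nFLR; nI] nQ).
split.
  move=> _ /FplusP[y ->] ny; rewrite (interp_comp nQ y).
  by case: y ny => // ny; case: ny => /=; tauto.
split; first by move=> X Y _ _ [/leJ_sub XY /leJ_sub YX]; apply: subF_anti.
split; first exact: idempotents.
split; first exact: idempotent_generated.
exact: coverings.
Qed.
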